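(* Let $d\ge 7$ be an integer with $d\equiv 3\pmod 4$, put $d'=\lfloor d/4\rfloor$, let $k$ be a rational and $\varepsilon$ a positive real such that $$2\le k<2+\frac{1}{2d'}\qquad\text{and}\qquad \varepsilon+\varepsilon k\sum_{j=0}^{d'-1}(k-1)^{2j+1}\ \ge\ 1.$$ If $G$ is a fractionally $k$-colorable graph and $W\subseteq V(G)$ is a set of vertices at pairwise distance at least $d$, then every fractional $(k+\varepsilon)$-precoloring of $W$ extends to a fractional $(k+\varepsilon)$-coloring of $G$.
   Context: A fractional $m$-coloring of a graph (real $m>0$) assigns to each vertex a measurable subset of $[0,m)$ of Lebesgue measure one so that adjacent vertices receive disjoint sets; a graph is fractionally $k$-colorable if it has a fractional $k$-coloring. A fractional $m$-precoloring of a vertex set $W$ assigns measurable subsets of $[0,m)$ of measure one to the vertices of $W$; it extends if some fractional $m$-coloring of the whole graph agrees with it on $W$. Graphs are finite. *)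

(* Defs.v *)
From Stdlib Require Import Reals Lra Lia List ZArith.
Open Scope R_scope.

Definition cover_le (A : R -> Prop) (r : R) : Prop :=
  forall eps : R, 0 < eps ->
    exists (a b : nat -> R) (l : R),
      (forall n, a n <= b n) /\
      (forall x, A x -> exists n, a n <= x < b n) /\
      infinite_sum (fun n => b n - a n) l /\ l <= r + eps.

Definition outer_measure_eq (A : R -> Prop) (r : R) : Prop :=
  cover_le A r /\ forall s, cover_le A s -> r <= s.

(** Caratheodory (= Lebesgue) measurability.  Test sets E of infinite outer
    measure satisfy the Caratheodory identity trivially, so only finite ones
    are tested. *)
Definition lebesgue_measurable (A : R -> Prop) : Prop :=
  forall (E : R -> Prop) (r : R), outer_measure_eq E r ->
    exists r1 r2,
      outer_measure_eq (fun x => E x /\ A x) r1 /\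
      outer_measure_eq (fun x => E x /\ ~ A x) r2 /\ r1 + r2 = r.

Definition unit_color_set (m : R) (S : R -> Prop) : Prop :=
  (forall x, S x -> 0 <= x < m) /\ lebesgue_measurable S /\ outer_measure_eq S 1.

Definition finite_graph (V : Type) (adj : V -> V -> Prop) : Prop :=
  (exists l : list V, forall v, In v l) /\
  (forall u v, adj u v -> adj v u) /\ (forall v, ~ adj v v).

Definition fractional_coloring (V : Type) (adj : V -> V -> Prop) (m : R)
  (c : V -> R -> Prop) : Prop :=
  (forall v, unit_color_set m (c v)) /\
  (forall u v, adj u v -> forall x, ~ (c u x /\ c v x)).

Definition fractionally_colorable (V : Type) (adj : V -> V -> Prop) (m : R) : Prop :=
  exists c, fractional_coloring V adj m c.

Definition fractional_precoloring (V : Type) (W : V -> Prop) (m : R)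
  (p : V -> R -> Prop) : Prop :=
  forall v, W v -> unit_color_set m (p v).

Definition precoloring_extends (V : Type) (adj : V -> V -> Prop) (W : V -> Prop)
  (m : R) (p : V -> R -> Prop) : Prop :=
  exists c, fractional_coloring V adj m c /\
    forall v, W v -> forall x, c v x <-> p v x.

Inductive walk (V : Type) (adj : V -> V -> Prop) : V -> V -> nat -> Prop :=
| walk_nil : forall v, walk V adj v v 0
| walk_cons : forall u w v n, adj u w -> walk V adj w v n -> walk V adj u v (S n).

(** Distinct vertices of W are at distance at least d (distance = length of a
    shortest walk; infinite if disconnected). *)
Definition pairwise_far (V : Type) (adj : V -> V -> Prop) (W : V -> Prop) (d : nat) : Prop :=
  forall u v, W u -> W v -> u <> v -> forall n, walk V adj u v n -> (d <= n)%nat.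

Definition is_rational (k : R) : Prop :=
  exists (p : Z) (q : positive), k = IZR p / IZR (Zpos q).

(* Main.v *)
Require Import Defs.
From Stdlib Require Import Reals List ZArith Lra Lia Psatz.
From Stdlib Require Import Classical ClassicalEpsilon FunctionalExtensionality PropExtensionality.
Open Scope R_scope.

(** Write [d = 4 n + 3] and [m = k + eps]. The balls of radius [2 n + 1] around the
    vertices of [W] are disjoint, and since [k < 2 + 1/(2 n)] rules out short odd closed
    walks, each sphere of radius at most [2 n] is an independent set. Choose
    [t : [0,m) -> [0,k)] and [lev : [0,m) -> [0,1)] that are independent and uniformly
    distributed conditionally on every atom of the algebra generated by the (finitely many)
    precoloured sets. Outside the balls a vertex [u] may use the colours [x] with
    [t x] in [f u], where [f] is the given fractional [k]-colouring; these have measure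
    [m / k > 1]. At distance [i >= 1] from [w] the
    palette of [u] is obtained from this default by adding the colours of the part [P_i] of
    level below [th_i] and dropping those of [P_(i-1)] of level below [th_(i-1)], where
    [P_i] is the set of [w] for even [i] and its complement for odd [i]. Palettes of
    neighbours are disjoint, and with [x_i := th_i * |P_i|] the palette has measure at least
    one as soon as [x_(i-1) <= eps + (k - 1) x_i]. Starting from [x_(2n+1) = 0] one can
    reach [x_0 = 1], i.e. free the whole set of [w], exactly when
    [eps * (1 + (k-1) + ... + (k-1)^(2n)) >= 1], which is the hypothesis on [eps]. *)

Local Notation meas := lebesgue_measurable.

(** * Lebesgue measure from covers by intervals *)

Lemma set_ext (A B : R -> Prop) : (forall x, A x <-> B x) -> A = B.
Proof.
  intros H; apply functional_extensionality; intros x.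
  apply propositional_extensionality; apply H.
Qed.

Definition cap (A B : R -> Prop) : R -> Prop := fun x => A x /\ B x.
Definition diff (A B : R -> Prop) : R -> Prop := fun x => A x /\ ~ B x.
Definition cup (A B : R -> Prop) : R -> Prop := fun x => A x \/ B x.
Definition below (c : R) : R -> Prop := fun x => x < c.
Definition seg (m : R) : R -> Prop := fun x => 0 <= x < m.

Lemma sum_le_sum_of_nonneg (u : nat -> R) (N N' : nat) :
  (forall n, 0 <= u n) -> (N <= N')%nat -> sum_f_R0 u N <= sum_f_R0 u N'.
Proof.
  intros Hu H; induction H as [|N' H IH]; [lra|].
  simpl; specialize (Hu (S N')); lra.
Qed.

Lemma infinite_sum_of_bounded (u : nat -> R) (r : R) :
  (forall n, 0 <= u n) -> (forall N, sum_f_R0 u N <= r) ->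
  exists l, infinite_sum u l /\ l <= r.
Proof.
  intros Hu Hb.
  destruct (growing_cv (sum_f_R0 u)) as [l Hl].
  - intros n; apply sum_le_sum_of_nonneg; [assumption|lia].
  - exists r; intros x [N ->]; apply Hb.
  - exists l; split.
    + intros e He; destruct (Hl e He) as [N HN]; exists N; exact HN.
    + apply Rnot_lt_le; intros Hlt.
      destruct (Hl (l - r)) as [N HN]; [lra|].
      specialize (HN N (Nat.le_refl N)); specialize (Hb N).
      unfold Rdist in HN; apply Rabs_def2 in HN; lra.
Qed.

Lemma partial_sum_le_infinite_sum (u : nat -> R) (l : R) (N : nat) :
  (forall n, 0 <= u n) -> infinite_sum u l -> sum_f_R0 u N <= l.
Proof.
  intros Hu Hl; apply Rnot_lt_le; intros Hlt.
  destruct (Hl (sum_f_R0 u N - l)) as [N0 HN]; [lra|].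
  specialize (HN (Nat.max N N0) (Nat.le_max_r _ _)).
  pose proof (sum_le_sum_of_nonneg u N (Nat.max N N0) Hu (Nat.le_max_l _ _)).
  unfold Rdist in HN; apply Rabs_def2 in HN; lra.
Qed.

(** Bounding every partial sum, instead of the limit, lets covers be compared without a convergence
    argument. *)
Definition covered_within (A : R -> Prop) (r : R) : Prop :=
  exists a b : nat -> R,
    (forall n, a n <= b n) /\
    (forall x, A x -> exists n, a n <= x < b n) /\
    (forall N, sum_f_R0 (fun n => b n - a n) N <= r).

Lemma cover_le_iff (A : R -> Prop) (r : R) :
  cover_le A r <-> forall eps, 0 < eps -> covered_within A (r + eps).
Proof.
  split; intros H eps He.
  - destruct (H eps He) as (a & b & l & Hab & HA & Hl & Hle).
    exists a, b; repeat split; auto; intros N.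
    apply Rle_trans with l; auto.
    apply partial_sum_le_infinite_sum; auto.
    intros n; specialize (Hab n); lra.
  - destruct (H eps He) as (a & b & Hab & HA & Hs).
    destruct (infinite_sum_of_bounded (fun n => b n - a n) (r + eps)) as (l & Hl & Hle); auto.
    + intros n; specialize (Hab n); lra.
    + exists a, b, l; auto.
Qed.

Lemma covered_within_cover_le (A : R -> Prop) (r : R) : covered_within A r -> cover_le A r.
Proof.
  intros (a & b & H1 & H2 & H3); apply cover_le_iff; intros eps He.
  exists a, b; repeat split; auto; intros N; specialize (H3 N); lra.
Qed.

Lemma cover_le_weaken (A B : R -> Prop) (r s : R) :
  (forall x, B x -> A x) -> r <= s -> cover_le A r -> cover_le B s.
Proof.
  intros HBA Hrs; rewrite !cover_le_iff; intros H eps He.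
  destruct (H eps He) as (a & b & H1 & H2 & H3).
  exists a, b; repeat split; auto; intros N; specialize (H3 N); lra.
Qed.

Lemma cover_le_nonneg (A : R -> Prop) (r : R) : cover_le A r -> 0 <= r.
Proof.
  rewrite cover_le_iff; intros H; apply Rnot_lt_le; intros Hr.
  destruct (H (- r / 2)) as (a & b & H1 & _ & H3); [lra|].
  specialize (H3 0%nat); specialize (H1 0%nat); simpl in H3; lra.
Qed.

Definition interleave (u v : nat -> R) (n : nat) : R :=
  if Nat.even n then u (Nat.div2 n) else v (Nat.div2 n).

Lemma interleave_even (u v : nat -> R) (n : nat) : interleave u v (2 * n) = u n.
Proof.
  unfold interleave; rewrite Nat.div2_double.
  replace (Nat.even (2 * n)) with true; auto.
  symmetry; apply Nat.even_spec; exists n; lia.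
Qed.

Lemma interleave_odd (u v : nat -> R) (n : nat) : interleave u v (S (2 * n)) = v n.
Proof.
  unfold interleave; rewrite Nat.div2_succ_double.
  replace (Nat.even (S (2 * n))) with false; auto.
  symmetry; rewrite Nat.even_succ, <- Nat.negb_even.
  replace (Nat.even (2 * n)) with true; auto.
  symmetry; apply Nat.even_spec; exists n; lia.
Qed.

Lemma sum_interleave (w : nat -> R) (N : nat) :
  sum_f_R0 w (S (2 * N)) =
  sum_f_R0 (fun n => w (2 * n)%nat) N + sum_f_R0 (fun n => w (S (2 * n))) N.
Proof.
  induction N as [|N IH]; [reflexivity|].
  replace (2 * S N)%nat with (S (S (2 * N))) by lia.
  rewrite tech5, tech5, IH, !(tech5 _ N).
  replace (2 * S N)%nat with (S (S (2 * N))) by lia; ring.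
Qed.

Lemma cover_le_cup (A B : R -> Prop) (r s : R) :
  cover_le A r -> cover_le B s -> cover_le (cup A B) (r + s).
Proof.
  rewrite !cover_le_iff; intros HA HB eps He.
  destruct (HA (eps / 2)) as (a & b & H1 & H2 & H3); [lra|].
  destruct (HB (eps / 2)) as (a' & b' & H1' & H2' & H3'); [lra|].
  assert (Hnn : forall n, interleave a a' n <= interleave b b' n).
  { intros n; unfold interleave; destruct (Nat.even n); auto. }
  exists (interleave a a'), (interleave b b'); repeat split; auto.
  - intros x [Hx | Hx].
    + destruct (H2 x Hx) as [n Hn]; exists (2 * n)%nat; rewrite !interleave_even; auto.
    + destruct (H2' x Hx) as [n Hn]; exists (S (2 * n)); rewrite !interleave_odd; auto.
  - intros N.
    (* The cut-off [S (2 * N)] takes exactly the first [N + 1] intervals of each cover; going there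
       from [N] only adds nonnegative lengths. *)
    apply Rle_trans with (sum_f_R0 (fun n => interleave b b' n - interleave a a' n) (S (2 * N))).
    + apply sum_le_sum_of_nonneg; [|lia]; intros n; specialize (Hnn n); lra.
    + rewrite sum_interleave.
      rewrite (sum_eq _ (fun n => b n - a n)) by (intros; rewrite !interleave_even; auto).
      rewrite (sum_eq (fun n => interleave b b' (S (2 * n)) - interleave a a' (S (2 * n)))
                 (fun n => b' n - a' n)) by (intros; rewrite !interleave_odd; auto).
      specialize (H3 N); specialize (H3' N); lra.
Qed.

Lemma covered_within_interval (a b : R) :
  a <= b -> covered_within (fun x => a <= x < b) (b - a).
Proof.
  intros Hab.
  exists (fun _ => a), (fun n => match n with O => b | S _ => a end); repeat split.
  - intros [|n]; lra.
  - intros x Hx; exists 0%nat; auto.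
  - intros N; induction N as [|N IH]; [simpl; lra|].
    rewrite tech5; lra.
Qed.

(* Arbitrary unless [fin A]. *)
Definition mu (A : R -> Prop) : R :=
  epsilon (inhabits 0) (fun r => outer_measure_eq A r).
Definition fin (A : R -> Prop) : Prop := exists r, cover_le A r.

Lemma outer_measure_eq_unique (A : R -> Prop) (r s : R) :
  outer_measure_eq A r -> outer_measure_eq A s -> r = s.
Proof.
  intros [H1 H2] [H3 H4]; specialize (H2 _ H3); specialize (H4 _ H1); lra.
Qed.

Lemma mu_spec (A : R -> Prop) : fin A -> outer_measure_eq A (mu A).
Proof.
  intros [r Hr]; unfold mu; apply epsilon_spec.
  (* The infimum of the admissible bounds is obtained as minus the supremum of their negatives. *)
  destruct (completeness (fun s => cover_le A (- s))) as [m [Hub Hlub]].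
  - exists 0; intros s Hs; apply cover_le_nonneg in Hs; lra.
  - exists (- r); rewrite Ropp_involutive; auto.
  - exists (- m); split.
    + apply cover_le_iff; intros eps He.
      destruct (classic (exists s, cover_le A (- s) /\ m - eps / 2 < s)) as [(s & Hs & Hms)|Hno].
      * rewrite cover_le_iff in Hs.
        destruct (Hs (eps / 2)) as (a & b & H1 & H2 & H3); [lra|].
        exists a, b; repeat split; auto; intros N; specialize (H3 N); lra.
      * exfalso; assert (m <= m - eps / 2); [|lra].
        apply Hlub; intros s Hs; apply Rnot_lt_le; intros Hlt; apply Hno; eauto.
    + intros s Hs; assert (- s <= m); [|lra].
      apply Hub; rewrite Ropp_involutive; auto.
Qed.

Lemma mu_eq (A : R -> Prop) (r : R) : outer_measure_eq A r -> mu A = r.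
Proof.
  intros H; apply (outer_measure_eq_unique A); auto.
  apply mu_spec; exists r; apply H.
Qed.

Lemma mu_le (A : R -> Prop) (r : R) : cover_le A r -> mu A <= r.
Proof.
  intros H; destruct (mu_spec A) as [_ H2]; [exists r; auto|auto].
Qed.

Lemma fin_subset (A B : R -> Prop) : (forall x, B x -> A x) -> fin A -> fin B.
Proof. intros H [r Hr]; exists r; eapply cover_le_weaken; eauto; lra. Qed.

Lemma fin_seg (m : R) : fin (seg m).
Proof.
  destruct (Rle_dec 0 m) as [H|H].
  - exists (m - 0); apply covered_within_cover_le, covered_within_interval; auto.
  - exists (0 - 0); apply (cover_le_weaken (fun x => 0 <= x < 0) _ (0 - 0)); [|lra|].
    + unfold seg; intros; lra.
    + apply covered_within_cover_le, covered_within_interval; lra.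
Qed.

Lemma fin_bounded (A : R -> Prop) (m : R) : (forall x, A x -> 0 <= x < m) -> fin A.
Proof. intros H; apply (fin_subset (seg m)); auto using fin_seg. Qed.

Lemma mu_mono (A B : R -> Prop) : (forall x, B x -> A x) -> fin A -> mu B <= mu A.
Proof.
  intros H HA; apply mu_le; apply (cover_le_weaken A _ (mu A)); auto; [lra|].
  apply mu_spec; auto.
Qed.

Lemma mu_nonneg (A : R -> Prop) : fin A -> 0 <= mu A.
Proof. intros HA; apply (cover_le_nonneg A); apply mu_spec; auto. Qed.

Lemma mu_cup_le (A B : R -> Prop) : fin A -> fin B -> mu (cup A B) <= mu A + mu B.
Proof. intros HA HB; apply mu_le, cover_le_cup; apply mu_spec; auto. Qed.

Lemma mu_split_le (E A : R -> Prop) : fin E -> mu E <= mu (cap E A) + mu (diff E A).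
Proof.
  intros HE; rewrite <- mu_cup_le.
  - apply Req_le; f_equal; apply set_ext; intros x; unfold cup, cap, diff.
    destruct (classic (A x)); tauto.
  - apply (fin_subset E); auto; unfold cap; tauto.
  - apply (fin_subset E); auto; unfold diff; tauto.
Qed.

Lemma mu_empty (A : R -> Prop) : (forall x, ~ A x) -> mu A = 0.
Proof.
  intros H; apply Rle_antisym.
  - apply mu_le.
    apply (cover_le_weaken (fun x => 0 <= x < 0) _ (0 - 0)); [|lra|].
    + intros x Hx; destruct (H x Hx).
    + apply covered_within_cover_le, covered_within_interval; lra.
  - apply mu_nonneg, (fin_bounded _ 0); intros x Hx; destruct (H x Hx).
Qed.

(** * Caratheodory measurable sets and additivity *)

Lemma mu_split (E A : R -> Prop) : meas A -> fin E -> mu E = mu (cap E A) + mu (diff E A).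
Proof.
  intros HA HE; destruct (HA E (mu E) (mu_spec E HE)) as (r1 & r2 & H1 & H2 & H).
  apply mu_eq in H1; apply mu_eq in H2; unfold cap, diff; lra.
Qed.

(** The reverse inequality is subadditivity, [mu_split_le], so only this direction has to be
    checked. *)
Lemma meas_of_split (A : R -> Prop) :
  (forall E, fin E -> mu (cap E A) + mu (diff E A) <= mu E) -> meas A.
Proof.
  intros H E r Hr; exists (mu (cap E A)), (mu (diff E A)).
  assert (HE : fin E) by (exists r; apply Hr).
  split; [|split].
  - apply mu_spec, (fin_subset E); auto; unfold cap; tauto.
  - apply mu_spec, (fin_subset E); auto; unfold diff; tauto.
  - rewrite <- (mu_eq E r Hr); apply Rle_antisym; auto using mu_split_le.
Qed.

Lemma meas_compl (A : R -> Prop) : meas A -> meas (fun x => ~ A x).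
Proof.
  intros HA; apply meas_of_split; intros E HE; rewrite (mu_split E A HA HE).
  apply Req_le; rewrite Rplus_comm; f_equal; f_equal; apply set_ext; intros x;
    unfold cap, diff; split; try tauto; intros [H1 H2]; split; auto; apply NNPP; auto.
Qed.

(** Cutting [E] by [A] and then [cap E A] by [B] gives three pieces; the two outside [cap A B]
    recombine, because [A] also splits [diff E (cap A B)] additively. *)
Lemma meas_cap (A B : R -> Prop) : meas A -> meas B -> meas (cap A B).
Proof.
  intros HA HB; apply meas_of_split; intros E HE.
  assert (HF : fin (diff E (cap A B))) by (apply (fin_subset E); auto; unfold diff; tauto).
  assert (HEA : fin (cap E A)) by (apply (fin_subset E); auto; unfold cap; tauto).
  rewrite (mu_split _ A HA HF), (mu_split E A HA HE), (mu_split _ B HB HEA).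
  replace (cap (diff E (cap A B)) A) with (diff (cap E A) B)
    by (apply set_ext; intros x; unfold cap, diff; tauto).
  replace (diff (diff E (cap A B)) A) with (diff E A)
    by (apply set_ext; intros x; unfold cap, diff; tauto).
  replace (cap E (cap A B)) with (cap (cap E A) B)
    by (apply set_ext; intros x; unfold cap, diff; tauto).
  lra.
Qed.

Lemma meas_diff (A B : R -> Prop) : meas A -> meas B -> meas (diff A B).
Proof. intros HA HB; exact (meas_cap A _ HA (meas_compl B HB)). Qed.

Lemma meas_cup (A B : R -> Prop) : meas A -> meas B -> meas (cup A B).
Proof.
  intros HA HB.
  replace (cup A B) with (fun x => ~ cap (fun x => ~ A x) (fun x => ~ B x) x).
  - apply meas_compl, meas_cap; apply meas_compl; auto.
  - apply set_ext; intros x; unfold cap, cup; destruct (classic (A x)), (classic (B x)); tauto.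
Qed.

Lemma meas_empty (A : R -> Prop) : (forall x, ~ A x) -> meas A.
Proof.
  intros H; apply meas_of_split; intros E HE.
  rewrite (mu_empty (cap E A)) by (intros x [_ Hx]; apply (H x Hx)).
  replace (diff E A) with E; [lra|].
  apply set_ext; intros x; unfold diff; specialize (H x); tauto.
Qed.

Lemma mu_disjoint_cup (A B : R -> Prop) :
  meas A -> (forall x, A x -> ~ B x) -> fin A -> fin B -> mu (cup A B) = mu A + mu B.
Proof.
  intros HA Hd HfA HfB.
  assert (Hf : fin (cup A B)).
  { destruct HfA as [r Hr], HfB as [s Hs]; exists (r + s); apply cover_le_cup; auto. }
  rewrite (mu_split _ A HA Hf); f_equal; f_equal; apply set_ext; intros x;
    specialize (Hd x); unfold cup, cap, diff; tauto.
Qed.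

(** Cutting each interval of a nearly optimal cover of [E] at [c] yields covers of both parts of [E]
    with the same total length. *)
Lemma meas_below (c : R) : meas (below c).
Proof.
  apply meas_of_split; intros E HE; apply le_epsilon; intros eps He.
  destruct (mu_spec E HE) as [HE' _]; rewrite cover_le_iff in HE'.
  destruct (HE' eps He) as (a & b & Hab & Hcov & Hsum).
  set (a1 := fun n => Rmin (a n) c); set (b1 := fun n => Rmin (b n) c).
  set (a2 := fun n => Rmax (a n) c); set (b2 := fun n => Rmax (b n) c).
  assert (H1 : forall n, 0 <= b1 n - a1 n).
  { intros n; specialize (Hab n); unfold a1, b1, Rmin; repeat destruct Rle_dec; lra. }
  assert (H2 : forall n, 0 <= b2 n - a2 n).
  { intros n; specialize (Hab n); unfold a2, b2, Rmax; repeat destruct Rle_dec; lra. }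
  assert (H12 : forall N, sum_f_R0 (fun n => b1 n - a1 n) N + sum_f_R0 (fun n => b2 n - a2 n) N
                          <= mu E + eps).
  { intros N; rewrite <- sum_plus; rewrite <- (Hsum N); apply Req_le, sum_eq; intros n _.
    specialize (Hab n); unfold a1, b1, a2, b2, Rmin, Rmax; repeat destruct Rle_dec; lra. }
  destruct (infinite_sum_of_bounded _ (mu E + eps) H1) as (l1 & Hl1 & _).
  { intros N; specialize (H12 N); pose proof (cond_pos_sum _ N H2); lra. }
  destruct (infinite_sum_of_bounded _ (mu E + eps) H2) as (l2 & Hl2 & _).
  { intros N; specialize (H12 N); pose proof (cond_pos_sum _ N H1); lra. }
  assert (Hl : l1 + l2 <= mu E + eps).
  { apply le_epsilon; intros e He'.
    destruct (Hl1 (e / 2)) as [N1 HN1]; [lra|]; destruct (Hl2 (e / 2)) as [N2 HN2]; [lra|].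
    specialize (HN1 (Nat.max N1 N2) (Nat.le_max_l _ _)).
    specialize (HN2 (Nat.max N1 N2) (Nat.le_max_r _ _)).
    specialize (H12 (Nat.max N1 N2)).
    unfold Rdist in *; apply Rabs_def2 in HN1; apply Rabs_def2 in HN2; lra. }
  assert (mu (cap E (below c)) <= l1).
  { apply mu_le, covered_within_cover_le; exists a1, b1; repeat split.
    - intros n; specialize (H1 n); lra.
    - intros x [Hx Hc]; destruct (Hcov x Hx) as [n Hn]; exists n.
      unfold below in Hc; unfold a1, b1, Rmin; repeat destruct Rle_dec; lra.
    - intros N; apply partial_sum_le_infinite_sum; auto. }
  assert (mu (diff E (below c)) <= l2).
  { apply mu_le, covered_within_cover_le; exists a2, b2; repeat split.
    - intros n; specialize (H2 n); lra.
    - intros x [Hx Hc]; destruct (Hcov x Hx) as [n Hn]; exists n.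
      unfold below in Hc; unfold a2, b2, Rmax; repeat destruct Rle_dec; lra.
    - intros N; apply partial_sum_le_infinite_sum; auto. }
  lra.
Qed.

Lemma meas_seg (m : R) : meas (seg m).
Proof.
  replace (seg m) with (diff (below m) (below 0)).
  - apply meas_diff; apply meas_below.
  - apply set_ext; intros x; unfold diff, below, seg; lra.
Qed.

(* Continuous induction replaces Heine-Borel: once the intervals [a n, b n) are widened to
   the left by [e / 2^(n+1)], the set [T] of those [x <= m] left of which finitely many of
   them have total length at least [x] has supremum [m]. *)
Lemma covered_within_seg (m r : R) : 0 <= m -> covered_within (seg m) r -> m <= r.
Proof.
  intros Hm (a & b & Hab & Hcov & Hsum); apply le_epsilon; intros e0 He0.
  set (e := e0 / 2); assert (He : 0 < e) by (unfold e; lra).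
  set (a' := fun n => a n - e * (/ 2) ^ (S n)).
  assert (Hpow : forall n, 0 < (/ 2) ^ n) by (intros n; apply pow_lt; lra).
  assert (Ha' : forall n, a' n < a n).
  { intros n; unfold a'; specialize (Hpow (S n)); nra. }
  (* [h n x] is the length of what the widened interval [n] has to the left of [x]. *)
  set (h := fun n x => Rmax 0 (Rmin (b n) x - a' n)).
  assert (Hhn : forall n x, 0 <= h n x) by (intros; apply Rmax_l).
  assert (Hhmono : forall n x y, x <= y -> h n x <= h n y).
  { intros n x y Hxy; unfold h, Rmax, Rmin; repeat destruct Rle_dec; lra. }
  assert (Hsum' : forall N x, sum_f_R0 (fun n => h n x) N <= r + e).
  { intros N x.
    apply Rle_trans with (sum_f_R0 (fun n => (b n - a n) + (/ 2) ^ (S n) * e) N).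
    - apply sum_Rle; intros n _; unfold h.
      specialize (Hab n); specialize (Ha' n).
      apply Rle_trans with (b n - a' n); [|unfold a'; lra].
      unfold Rmax, Rmin; repeat destruct Rle_dec; lra.
    - rewrite sum_plus; apply Rplus_le_compat; auto.
      rewrite <- scal_sum.
      assert (sum_f_R0 (fun n => (/ 2) ^ (S n)) N = 1 - (/ 2) ^ (S N)) as ->.
      { clear; induction N as [|N IH]; [simpl; lra|].
        rewrite tech5, IH; simpl; lra. }
      specialize (Hpow (S N)); nra. }
  set (T := fun x => 0 <= x <= m /\ exists N, x <= sum_f_R0 (fun n => h n x) N).
  assert (HT0 : T 0).
  { split; [lra|]; exists 0%nat; apply cond_pos_sum; auto. }
  destruct (completeness T) as [s [Hub Hlub]].
  { exists m; intros x [Hx _]; lra. }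
  { exists 0; auto. }
  assert (Hnear : forall z, z < s -> exists x, T x /\ z < x).
  { intros z Hz; apply NNPP; intros Hno; assert (s <= z); [|lra].
    apply Hlub; intros x Hx; apply Rnot_lt_le; intros Hlt; apply Hno; eauto. }
  assert (Hs0 : 0 <= s) by (apply Hub; auto).
  destruct (Rlt_dec s m) as [Hsm|Hsm].
  (* If [s < m], the interval [i] holding [s] reaches beyond [s], and once widened it starts before
     some [x] in [T]. Passing from [x] to [y] then gains the full [y - x] in the term [i], so [T]
     contains [y > s]. *)
  - exfalso; destruct (Hcov s) as [i Hi]; [split; auto|].
    destruct (Hnear (a' i)) as (x & [Hx [N HN]] & Hxi); [specialize (Ha' i); lra|].
    assert (Hxs : x <= s) by (apply Hub; split; eauto).
    set (y := Rmin (b i) m).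
    assert (Hy : s < y /\ y <= b i /\ y <= m).
    { unfold y, Rmin; destruct Rle_dec; lra. }
    assert (T y); [|assert (y <= s) by auto; lra].
    split; [lra|]; exists (Nat.max N i).
    assert (Hgain : forall K, (i <= K)%nat ->
      sum_f_R0 (fun n => h n x) K + (y - x) <= sum_f_R0 (fun n => h n y) K).
    { assert (Hi' : h i x + (y - x) <= h i y).
      { unfold h, Rmax, Rmin; repeat destruct Rle_dec; lra. }
      intros K HK; induction HK as [|K HK IH].
      - destruct i as [|i]; [simpl; auto|].
        rewrite !tech5.
        assert (sum_f_R0 (fun n => h n x) i <= sum_f_R0 (fun n => h n y) i).
        { apply sum_Rle; intros; apply Hhmono; lra. }
        lra.
      - rewrite !tech5; specialize (Hhmono (S K) x y); lra. }
    specialize (Hgain (Nat.max N i) (Nat.le_max_r _ _)).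
    pose proof (sum_le_sum_of_nonneg (fun n => h n x) N (Nat.max N i)
                  (fun n => Hhn n x) (Nat.le_max_l _ _)); lra.
  - destruct (Hnear (m - e)) as (x & [Hx [N HN]] & Hxe); [lra|].
    specialize (Hsum' N x); unfold e in *; lra.
Qed.

Lemma mu_seg (m : R) : 0 <= m -> mu (seg m) = m.
Proof.
  intros Hm; apply Rle_antisym.
  - apply mu_le, covered_within_cover_le.
    replace m with (m - 0) at 2 by ring; apply covered_within_interval; auto.
  - destruct (mu_spec (seg m) (fin_seg m)) as [H _]; rewrite cover_le_iff in H.
    apply le_epsilon; intros e He; apply covered_within_seg; auto.
Qed.

(** As a function of [c] the measure is monotone and, by subadditivity, 1-Lipschitz, so the
    intermediate value theorem applies. *)
Lemma exists_cut (A : R -> Prop) (m s : R) :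
  (forall x, A x -> 0 <= x < m) -> 0 <= s <= mu A -> exists c, mu (cap A (below c)) = s.
Proof.
  intros HA Hs.
  assert (Hf : fin A) by (eapply fin_bounded; eauto).
  assert (Hfb : forall c, fin (cap A (below c))).
  { intros c; apply (fin_subset A); auto; unfold cap; tauto. }
  set (g := fun c => mu (cap A (below c)) - s).
  assert (Hmono : forall x y, x <= y -> g x <= g y).
  { intros x y Hxy; unfold g; apply Rplus_le_compat_r, mu_mono; auto.
    unfold cap, below; intros z Hz; split; [tauto|lra]. }
  assert (Hlip : forall x y, x <= y -> g y - g x <= y - x).
  { intros x y Hxy.
    assert (mu (cap A (below y)) <= mu (cap A (below x)) + (y - x)); [|unfold g; lra].
    apply mu_le.
    apply (cover_le_weaken (cup (cap A (below x)) (fun z => x <= z < y)) _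
             (mu (cap A (below x)) + (y - x))); [|lra|].
    - unfold cup, cap, below; intros z [Hz1 Hz2].
      destruct (Rlt_dec z x); [left; auto|right; lra].
    - apply cover_le_cup; [apply mu_spec; auto|].
      apply covered_within_cover_le, covered_within_interval; auto. }
  assert (Hcont : continuity g).
  { intros x e He; exists e; split; auto; intros y [_ Hy]; simpl in *; unfold Rdist in *.
    apply Rabs_def2 in Hy; apply Rabs_def1.
    - destruct (Rle_dec x y) as [H|H]; [specialize (Hlip x y H); lra|].
      specialize (Hmono y x); lra.
    - destruct (Rle_dec y x) as [H|H]; [specialize (Hlip y x H); lra|].
      specialize (Hmono x y); lra. }
  assert (Hg0 : g 0 <= 0).
  { unfold g; rewrite mu_empty; [lra|].
    intros x [Hx Hx']; specialize (HA x Hx); unfold below in Hx'; lra. }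
  assert (Hgm : 0 <= g (Rmax 0 m)).
  { unfold g; replace (cap A (below (Rmax 0 m))) with A; [lra|].
    apply set_ext; intros x; unfold cap, below; split; [|tauto].
    intros Hx; split; auto; specialize (HA x Hx); pose proof (Rmax_r 0 m); lra. }
  destruct (IVT_cor g 0 (Rmax 0 m) Hcont) as [c [_ Hc]]; [apply Rmax_l|nra|].
  exists c; unfold g in Hc; lra.
Qed.

(** * Uniformly distributed maps *)

(** Lets palettes be built with measure at least one and trimmed at the end. *)
Lemma exists_unit_color_subset (m : R) (A : R -> Prop) :
  (forall x, A x -> 0 <= x < m) -> meas A -> 1 <= mu A ->
  exists B, unit_color_set m B /\ forall x, B x -> A x.
Proof.
  intros HA HmA H1; destruct (exists_cut A m 1 HA) as [c Hc]; [lra|].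
  assert (HB : forall x, cap A (below c) x -> A x) by (unfold cap; tauto).
  exists (cap A (below c)); split; auto; split; [auto|split].
  - apply meas_cap; auto using meas_below.
  - rewrite <- Hc; apply mu_spec, (fin_bounded _ m); auto.
Qed.

Lemma mu_unit_color_set (m : R) (S : R -> Prop) : unit_color_set m S -> mu S = 1.
Proof. intros (_ & _ & H); apply mu_eq; auto. Qed.

(* The clause "[U] empty implies [D] empty" makes [t] map [D] into [U] everywhere and
   not just almost everywhere. *)
Lemma exists_scaling_map (l : list (R -> Prop)) :
  Forall lebesgue_measurable l ->
  forall (D U : R -> Prop) (r m : R),
  0 <= r -> (forall x, D x -> 0 <= x < m) -> meas D -> fin U -> mu D = r * mu U ->
  ((forall y, ~ U y) -> forall x, ~ D x) ->
  exists t : R -> R, (forall x, D x -> U (t x)) /\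
    forall S, In S l -> meas (fun x => D x /\ S (t x)) /\
      mu (fun x => D x /\ S (t x)) = r * mu (cap U S).
Proof.
  (* The head [S] splits [U], a cut splits [D] in the same proportion, and the tail is handled on
     the two pieces separately; with no sets left a constant map will do. *)
  intros Hl; induction Hl as [|S l HS Hl IH]; intros D U r m Hr HD HmD HU Hmu Hemp.
  - destruct (classic (exists y, U y)) as [[y Hy]|Hno].
    + exists (fun _ => y); split; auto; intros S [].
    + exists (fun _ => 0); split; [|intros S []].
      intros x Hx; destruct (Hemp (fun y Hy => Hno (ex_intro _ y Hy)) x Hx).
  - assert (HUS : fin (cap U S)) by (apply (fin_subset U); auto; unfold cap; tauto).
    assert (HUS' : fin (diff U S)) by (apply (fin_subset U); auto; unfold diff; tauto).
    assert (HsplitU : mu U = mu (cap U S) + mu (diff U S)) by (apply mu_split; auto).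
    assert (HfD : fin D) by (eapply fin_bounded; eauto).
    pose proof (mu_nonneg _ HUS); pose proof (mu_nonneg _ HUS').
    assert (Hc : exists c, mu (cap D (below c)) = r * mu (cap U S) /\
      ((forall y, ~ cap U S y) -> forall x, ~ cap D (below c) x) /\
      ((forall y, ~ diff U S y) -> forall x, ~ diff D (below c) x)).
    (* When both parts of [U] are inhabited, the cut is chosen by measure. An empty part must
       receive no point at all, not just a null set, so there [c] is moved to [m] or [0]. *)
    { destruct (classic (exists y, cap U S y)) as [Hin|Hin];
      [destruct (classic (exists y, diff U S y)) as [Hout|Hout]|].
      - destruct (exists_cut D m (r * mu (cap U S)) HD) as [c Hc]; [rewrite Hmu; nra|].
        exists c; repeat split; auto; intros H'; exfalso.
        + destruct Hin as [y Hy]; apply (H' y Hy).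
        + destruct Hout as [y Hy]; apply (H' y Hy).
      - exists m; repeat split.
        + replace (cap D (below m)) with D.
          * rewrite Hmu, HsplitU, (mu_empty (diff U S)); [ring|].
            intros y Hy; apply Hout; eauto.
          * apply set_ext; intros x; unfold cap, below; split; [|tauto].
            intros Hx; split; auto; apply HD; auto.
        + intros H'; exfalso; destruct Hin as [y Hy]; apply (H' y Hy).
        + intros _ x [Hx Hx']; apply Hx'; unfold below; apply HD; auto.
      - exists 0; assert (Hnone : forall x, ~ cap D (below 0) x).
        { intros x [Hx Hx']; specialize (HD x Hx); unfold below in Hx'; lra. }
        repeat split; auto.
        + rewrite !mu_empty; auto; [ring|]; intros y Hy; apply Hin; eauto.
        + intros H' x [Hx _].
          apply (Hemp (fun y Hy => match classic (S y) with
                       | or_introl h => Hin (ex_intro _ y (conj Hy h))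
                       | or_intror h => H' y (conj Hy h) end) x Hx). }
    destruct Hc as (c & Hc & He1 & He2).
    assert (Hc2 : mu (diff D (below c)) = r * mu (diff U S)).
    { pose proof (mu_split D (below c) (meas_below c) HfD); rewrite HsplitU in Hmu; lra. }
    destruct (IH (cap D (below c)) (cap U S) r m) as (t1 & Ht1 & Ht1'); auto.
    { intros x [Hx _]; auto. }
    { apply meas_cap; auto using meas_below. }
    destruct (IH (diff D (below c)) (diff U S) r m) as (t2 & Ht2 & Ht2'); auto.
    { intros x [Hx _]; auto. }
    { apply meas_diff; auto using meas_below. }
    set (t := fun x => if Rlt_dec x c then t1 x else t2 x).
    assert (Hlow : forall x, D x -> x < c -> t x = t1 x /\ cap D (below c) x).
    { intros x Hx Hxc; unfold t, cap, below; destruct (Rlt_dec x c); tauto. }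
    assert (Hhigh : forall x, D x -> ~ x < c -> t x = t2 x /\ diff D (below c) x).
    { intros x Hx Hxc; unfold t, diff, below; destruct (Rlt_dec x c); tauto. }
    exists t; split.
    { intros x Hx; destruct (Rlt_dec x c) as [Hxc|Hxc].
      - destruct (Hlow x Hx Hxc) as [-> Hx']; apply Ht1; auto.
      - destruct (Hhigh x Hx Hxc) as [-> Hx']; apply Ht2; auto. }
    intros S' [<-|HS'].
    + replace (fun x => D x /\ S (t x)) with (cap D (below c)).
      * split; auto; apply meas_cap; auto using meas_below.
      * apply set_ext; intros x; split.
        -- intros [Hx Hxc]; split; auto; destruct (Hlow x Hx Hxc) as [-> Hx'].
           apply Ht1; auto.
        -- intros [Hx HSx]; split; auto; apply NNPP; intros Hxc.
           destruct (Hhigh x Hx Hxc) as [E Hx']; rewrite E in HSx.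
           destruct (Ht2 x Hx'); auto.
    + destruct (Ht1' S' HS') as [Hm1 Hv1]; destruct (Ht2' S' HS') as [Hm2 Hv2].
      assert (Hcup : (fun x => D x /\ S' (t x)) =
        cup (fun x => cap D (below c) x /\ S' (t1 x)) (fun x => diff D (below c) x /\ S' (t2 x))).
      { apply set_ext; intros x; unfold cup; split.
        - intros [Hx HSx]; destruct (Rlt_dec x c) as [Hxc|Hxc].
          + destruct (Hlow x Hx Hxc) as [E Hx']; rewrite E in HSx; auto.
          + destruct (Hhigh x Hx Hxc) as [E Hx']; rewrite E in HSx; auto.
        - intros [[Hx HSx]|[Hx HSx]]; pose proof Hx as [HDx Hxc].
          + destruct (Hlow x HDx Hxc) as [-> _]; auto.
          + destruct (Hhigh x HDx Hxc) as [-> _]; auto. }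
      rewrite Hcup; split; [apply meas_cup; auto|].
      rewrite mu_disjoint_cup, Hv1, Hv2; auto.
      * assert (HUS2 : fin (cap U S')) by (apply (fin_subset U); auto; unfold cap; tauto).
        rewrite (mu_split (cap U S') S HS HUS2).
        replace (cap (cap U S') S) with (cap (cap U S) S')
          by (apply set_ext; intros x; unfold cap; tauto).
        replace (diff (cap U S') S) with (cap (diff U S) S')
          by (apply set_ext; intros x; unfold cap, diff; tauto).
        ring.
      * intros x [[_ H1] _] [[_ H2] _]; auto.
      * apply (fin_subset D); auto; unfold cap; tauto.
      * apply (fin_subset D); auto; unfold diff; tauto.
Qed.

(* [B] agrees on [D] with a member of the Boolean algebra generated by [Xs]. *)
Definition saturated (Xs : list (R -> Prop)) (D B : R -> Prop) : Prop :=
  forall x y, D x -> D y -> (forall X, In X Xs -> (X x <-> X y)) -> B x -> B y.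

(** Induction on [Xs] splits [D] into the atoms of the algebra, and each atom gets its own scaling
    map into [U]. Within [D] a saturated [B] is a union of atoms, so the proportion of [S] in [U]
    reappears on it. *)
Lemma exists_independent_map (Xs l : list (R -> Prop)) (U : R -> Prop) (m : R) :
  Forall lebesgue_measurable Xs -> Forall lebesgue_measurable l -> fin U -> 0 < mu U ->
  forall D : R -> Prop, (forall x, D x -> 0 <= x < m) -> meas D ->
  exists t : R -> R, (forall x, D x -> U (t x)) /\
    forall B S, saturated Xs D B -> In S l -> meas (fun x => cap D B x /\ S (t x)) /\
      mu (fun x => cap D B x /\ S (t x)) = mu (cap D B) * (mu (cap U S) / mu U).
Proof.
  intros HXs Hl HU Hpos; induction HXs as [|X Xs HX HXs IH]; intros D HD HmD;
    assert (HfD : fin D) by (eapply fin_bounded; eauto).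
  - destruct (exists_scaling_map l Hl D U (mu D / mu U) m) as (t & Ht & Ht'); auto.
    { apply Rle_mult_inv_pos; auto; apply mu_nonneg; auto. }
    { field; lra. }
    { intros Hno; rewrite (mu_empty U Hno) in Hpos; lra. }
    exists t; split; auto; intros B S HB HS.
    (* With no set left to separate points, a saturated [B] contains all of [D] or misses it. *)
    destruct (classic (exists x, cap D B x)) as [[x [Hx HBx]]|Hno].
    + replace (cap D B) with D.
      * destruct (Ht' S HS) as [H1 H2]; split; auto; rewrite H2; field; lra.
      * apply set_ext; intros y; unfold cap; split; [|tauto].
        intros Hy; split; auto; apply (HB x y); auto; intros X [].
    + assert (Hno' : forall x, ~ (cap D B x /\ S (t x))) by (intros x [Hx _]; eauto).
      split; [apply meas_empty; auto|].
      rewrite (mu_empty _ Hno'), (mu_empty (cap D B)); [ring|]; intros x Hx; eauto.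
  - destruct (IH (cap D X)) as (t1 & Ht1 & Ht1').
    { intros x [Hx _]; auto. }
    { apply meas_cap; auto. }
    destruct (IH (diff D X)) as (t2 & Ht2 & Ht2').
    { intros x [Hx _]; auto. }
    { apply meas_diff; auto. }
    set (t := fun x => if excluded_middle_informative (X x) then t1 x else t2 x).
    assert (Hin : forall x, X x -> t x = t1 x).
    { intros x Hx; unfold t; destruct (excluded_middle_informative (X x)); tauto. }
    assert (Hout : forall x, ~ X x -> t x = t2 x).
    { intros x Hx; unfold t; destruct (excluded_middle_informative (X x)); tauto. }
    exists t; split.
    { intros x Hx; destruct (classic (X x)) as [HXx|HXx].
      - rewrite Hin; auto; apply Ht1; split; auto.
      - rewrite Hout; auto; apply Ht2; split; auto. }
    intros B S HB HS.
    destruct (Ht1' B S) as [Hm1 Hv1]; auto.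
    { intros x y [Hx HxX] [Hy HyX] Hxy; apply HB; auto.
      intros X' [<-|HX']; [tauto|auto]. }
    destruct (Ht2' B S) as [Hm2 Hv2]; auto.
    { intros x y [Hx HxX] [Hy HyX] Hxy; apply HB; auto.
      intros X' [<-|HX']; [tauto|auto]. }
    assert (Hcup : (fun x => cap D B x /\ S (t x)) =
      cup (fun x => cap (cap D X) B x /\ S (t1 x)) (fun x => cap (diff D X) B x /\ S (t2 x))).
    { apply set_ext; intros x; unfold cup, cap, diff; destruct (classic (X x)) as [HXx|HXx].
      - rewrite (Hin x HXx); tauto.
      - rewrite (Hout x HXx); tauto. }
    rewrite Hcup; split; [apply meas_cup; auto|].
    rewrite mu_disjoint_cup, Hv1, Hv2; auto.
    + assert (HDB : fin (cap D B)) by (apply (fin_subset D); auto; unfold cap; tauto).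
      rewrite (mu_split (cap D B) X HX HDB).
      replace (cap (cap D B) X) with (cap (cap D X) B)
        by (apply set_ext; intros x; unfold cap; tauto).
      replace (diff (cap D B) X) with (cap (diff D X) B)
        by (apply set_ext; intros x; unfold cap, diff; tauto).
      ring.
    + intros x [[[_ H1] _] _] [[[_ H2] _] _]; auto.
    + apply (fin_subset D); auto; unfold cap; tauto.
    + apply (fin_subset D); auto; unfold cap, diff; tauto.
Qed.

(** [lev] is built first; its level sets then join [ps] in the list from which [t] is made
    independent, so [t] stays uniform after conditioning on levels. *)
Lemma exists_level_and_color_maps (ps fs : list (R -> Prop)) (ths : list R) (m k : R) :
  0 < k -> Forall lebesgue_measurable ps ->
  Forall (fun th => 0 <= th <= 1) ths -> Forall (unit_color_set k) fs ->
  exists lev t : R -> R,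
    (forall x, seg m x -> seg 1 (lev x)) /\
    (forall B th, saturated ps (seg m) B -> In th ths ->
       meas (fun x => cap (seg m) B x /\ lev x < th) /\
       mu (fun x => cap (seg m) B x /\ lev x < th) = th * mu (cap (seg m) B)) /\
    (forall B F, saturated (ps ++ map (fun th x => lev x < th) ths) (seg m) B -> In F fs ->
       meas (fun x => cap (seg m) B x /\ F (t x)) /\
       mu (fun x => cap (seg m) B x /\ F (t x)) = mu (cap (seg m) B) / k).
Proof.
  intros Hk Hps Hths Hfs.
  (* On [seg m], the set [lev x < th] is the preimage of [seg th], whose proportion in [seg 1] is
     [th]. *)
  destruct (exists_independent_map ps (map seg ths) (seg 1) m) with (D := seg m)
    as (lev & Hlev & Hlev'); auto using fin_seg, meas_seg.
  { apply Forall_forall; intros S HS; apply in_map_iff in HS; destruct HS as (th & <- & _).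
    apply meas_seg. }
  { rewrite mu_seg; lra. }
  assert (HL : forall B th, saturated ps (seg m) B -> In th ths ->
       meas (fun x => cap (seg m) B x /\ lev x < th) /\
       mu (fun x => cap (seg m) B x /\ lev x < th) = th * mu (cap (seg m) B)).
  { intros B th HB Hth; destruct (Hlev' B (seg th)) as [H1 H2]; auto using in_map.
    rewrite Forall_forall in Hths; specialize (Hths th Hth).
    replace (fun x => cap (seg m) B x /\ lev x < th)
      with (fun x => cap (seg m) B x /\ seg th (lev x)).
    - split; auto; rewrite H2.
      replace (cap (seg 1) (seg th)) with (seg th);
        [|apply set_ext; intros x; unfold cap, seg; lra].
      rewrite !mu_seg by lra; field.
    - apply set_ext; intros x; unfold cap; split.
      + intros [Hx [_ Hx']]; auto.
      + intros [Hx Hx']; split; auto; split; auto; apply Hlev; tauto. }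
  (* Outside [seg m] the levels are not known to be measurable, so cut them down to it. *)
  destruct (exists_independent_map (ps ++ map (fun th x => seg m x /\ lev x < th) ths) fs
              (seg k) m) with (D := seg m) as (t & Ht & Ht'); auto using fin_seg, meas_seg.
  { apply Forall_app; split; auto.
    apply Forall_forall; intros S HS; apply in_map_iff in HS; destruct HS as (th & <- & Hth).
    destruct (HL (fun _ => True) th) as [H _]; auto; [intros ? ?; auto|].
    replace (fun x => seg m x /\ lev x < th) with (fun x => cap (seg m) (fun _ => True) x /\ lev x < th);
      auto.
    apply set_ext; intros x; unfold cap; tauto. }
  { rewrite Forall_forall in *; intros F HF; apply Hfs; auto. }
  { rewrite mu_seg; lra. }
  exists lev, t; split; [auto|split; [auto|]].
  intros B F HB HF; destruct (Ht' B F) as [H1 H2]; auto.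
  - intros x y Hx Hy Hxy; apply HB; auto; intros X HX.
    apply in_app_or in HX; destruct HX as [HX|HX]; [apply Hxy, in_or_app; auto|].
    apply in_map_iff in HX; destruct HX as (th & <- & Hth).
    specialize (Hxy (fun x => seg m x /\ lev x < th)); simpl in Hxy.
    assert (seg m x /\ lev x < th <-> seg m y /\ lev y < th); [|tauto].
    apply Hxy, in_or_app; right; apply in_map_iff; eauto.
  - split; auto; rewrite H2.
    rewrite Forall_forall in Hfs; specialize (Hfs F HF).
    replace (cap (seg k) F) with F.
    + rewrite (mu_unit_color_set k F Hfs), mu_seg; [field|]; lra.
    + apply set_ext; intros x; unfold cap; split; [|tauto].
      intros Hx; split; auto; apply Hfs; auto.
Qed.

(** * Walks and odd girth *)

Lemma walk_app (V : Type) (adj : V -> V -> Prop) (u v w : V) (i j : nat) :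
  walk V adj u v i -> walk V adj v w j -> walk V adj u w (i + j).
Proof. intros H; induction H; simpl; auto; intros Hw; econstructor; eauto. Qed.

Lemma walk_edge (V : Type) (adj : V -> V -> Prop) (u v : V) : adj u v -> walk V adj u v 1.
Proof. intros H; econstructor; [eauto|constructor]. Qed.

Lemma walk_sym (V : Type) (adj : V -> V -> Prop) (u v : V) (i : nat) :
  (forall u v, adj u v -> adj v u) -> walk V adj u v i -> walk V adj v u i.
Proof.
  intros Hs H; induction H as [|u w v n H Hw IH]; [constructor|].
  replace (S n) with (n + 1)%nat by lia; eapply walk_app; eauto using walk_edge.
Qed.

(* Two steps of a walk move a colour set by at most [k - 2], since both ends avoid the
   set of the middle vertex. *)
Lemma mu_diff_along_walk (V : Type) (adj : V -> V -> Prop) (k : R) (f : V -> R -> Prop) :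
  fractional_coloring V adj k f -> 0 <= k ->
  forall j u v, walk V adj u v (2 * j) -> mu (diff (f v) (f u)) <= INR j * (k - 2).
Proof.
  intros [Hu Hd] Hk; induction j as [|j IH]; intros u v Hw.
  - inversion Hw; subst; rewrite mu_empty; [simpl; lra|unfold diff; tauto].
  - replace (2 * S j)%nat with (S (S (2 * j))) in Hw by lia.
    inversion Hw as [|? x ? ? Hux Hw1]; subst; inversion Hw1 as [|? y ? ? Hxy Hw2]; subst.
    specialize (IH y v Hw2); rewrite S_INR.
    assert (Hfin : forall z, fin (f z)).
    { intros z; apply (fin_bounded _ k), Hu. }
    assert (Hfd : forall z z', fin (diff (f z) (f z'))).
    { intros z z'; apply (fin_subset (f z)); auto; unfold diff; tauto. }
    assert (Hstep : mu (diff (f y) (f u)) <= k - 2).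
    { assert (Hfc : fin (cup (f x) (f u))).
      { apply (fin_bounded _ k); intros c [Hc|Hc]; eapply Hu; eauto. }
      assert (Hall : mu (cup (cup (f x) (f u)) (diff (f y) (f u))) <= k).
      { apply Rle_trans with (mu (seg k)); [|rewrite mu_seg; lra].
        apply mu_mono; [|apply fin_seg].
        intros c [[Hc|Hc]|[Hc _]]; eapply Hu; eauto. }
      rewrite !mu_disjoint_cup in Hall; auto.
      - rewrite (mu_unit_color_set k (f x)), (mu_unit_color_set k (f u)) in Hall; auto; lra.
      - apply Hu.
      - intros c Hx Hc; apply (Hd u x Hux c); auto.
      - apply meas_cup; apply Hu.
      - intros c [Hc|Hc] [Hc1 Hc2]; auto; apply (Hd x y Hxy c); auto. }
    assert (mu (diff (f v) (f u)) <= mu (cup (diff (f v) (f y)) (diff (f y) (f u)))).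
    { apply mu_mono.
      - intros c; unfold cup, diff; destruct (classic (f y c)); tauto.
      - apply (fin_bounded _ k); intros c [[Hc _]|[Hc _]]; eapply Hu; eauto. }
    pose proof (mu_cup_le (diff (f v) (f y)) (diff (f y) (f u)) (Hfd _ _) (Hfd _ _)); lra.
Qed.

(** The walk and the edge form a closed walk of length [2 * j + 1]. Adjacency makes [f u] and [f v]
    disjoint, so the difference bounded along the walk is all of [f v], of measure one. *)
Lemma odd_closed_walk_bound (V : Type) (adj : V -> V -> Prop) (k : R) (f : V -> R -> Prop)
  (j : nat) (u v : V) :
  fractional_coloring V adj k f -> 0 <= k -> walk V adj u v (2 * j) -> adj u v ->
  1 <= INR j * (k - 2).
Proof.
  intros Hf Hk Hw Huv; rewrite <- (mu_diff_along_walk V adj k f Hf Hk j u v Hw).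
  destruct Hf as [Hu Hd].
  replace (diff (f v) (f u)) with (f v); [rewrite (mu_unit_color_set k); auto; lra|].
  apply set_ext; intros c; unfold diff; specialize (Hd u v Huv c); tauto.
Qed.

(** * Thresholds *)

(** The geometric sum [1 + (k - 1) + ... + (k - 1) ^ (m - 1)], in Horner form to match the recursion
    for the thresholds. *)
Fixpoint geo (k : R) (m : nat) : R :=
  match m with O => 0 | S m => 1 + (k - 1) * geo k m end.

Lemma geo_succ (k : R) (m : nat) : geo k (S m) = geo k m + (k - 1) ^ m.
Proof.
  induction m as [|m IH]; [simpl; ring|].
  change (geo k (S (S m))) with (1 + (k - 1) * geo k (S m)).
  rewrite IH at 1; simpl; ring.
Qed.

(** The powers of exponents [2 * j + 1] and [2 * j + 2] add up to [k] times the first; this links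
    [geo] to the hypothesis on [eps]. *)
Lemma geo_odd (k : R) (n : nat) :
  geo k (2 * S n + 1) = 1 + k * sum_f_R0 (fun j => (k - 1) ^ (2 * j + 1)) n.
Proof.
  induction n as [|n IH]; [simpl; ring|].
  replace (2 * S (S n) + 1)%nat with (S (S (2 * S n + 1))) by lia.
  rewrite 2!geo_succ, IH, tech5.
  change ((k - 1) ^ S (2 * S n + 1)) with ((k - 1) * (k - 1) ^ (2 * S n + 1)); ring.
Qed.

Lemma geo_nonneg (k : R) (m : nat) : 2 <= k -> 0 <= geo k m.
Proof. intros Hk; induction m as [|m IH]; simpl; [lra|nra]. Qed.

Lemma geo_mono (k : R) (m m' : nat) : 2 <= k -> (m <= m')%nat -> geo k m <= geo k m'.
Proof.
  intros Hk H; induction H as [|m' H IH]; [lra|].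
  rewrite geo_succ; pose proof (pow_lt (k - 1) m' ltac:(lra)); lra.
Qed.

Definition part_size (m : R) (i : nat) : R := if Nat.even i then 1 else m - 1.

(* [th_i = x_i / |P_i|] with [x_i] solving [x_(i-1) = delta + (k - 1) x_i], [x_(2n+1) = 0];
   the constant [delta = 1 / geo k (2 n + 1) <= eps] makes [x_0 = 1], so no capping at
   the full part is needed. *)
Definition threshold (k m : R) (n i : nat) : R :=
  geo k (2 * n + 1 - i) / geo k (2 * n + 1) / part_size m i.

Lemma part_size_ge1 (m : R) (i : nat) : 2 <= m -> 1 <= part_size m i.
Proof. intros; unfold part_size; destruct (Nat.even i); lra. Qed.

Lemma part_size_consecutive (m : R) (i : nat) : part_size m (S i) + part_size m i = m.
Proof.
  unfold part_size; rewrite Nat.even_succ, <- Nat.negb_even; destruct (Nat.even i); simpl; ring.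
Qed.

Lemma geo_odd_pos (k : R) (n : nat) : 2 <= k -> 0 < geo k (2 * n + 1).
Proof.
  intros Hk; replace (2 * n + 1)%nat with (S (2 * n)) by lia; simpl.
  pose proof (geo_nonneg k (n + (n + 0)) Hk); nra.
Qed.

Lemma div_le_1 (a b : R) : 0 < b -> a <= b -> a / b <= 1.
Proof.
  intros Hb Hab; apply (Rmult_le_reg_r b); auto; unfold Rdiv.
  rewrite Rmult_assoc, Rinv_l; lra.
Qed.

Lemma geo_ratio_range (k : R) (n i : nat) :
  2 <= k -> 0 <= geo k (2 * n + 1 - i) / geo k (2 * n + 1) <= 1.
Proof.
  intros Hk; pose proof (geo_odd_pos k n Hk).
  split; [apply Rle_mult_inv_pos; auto using geo_nonneg|].
  apply div_le_1; auto; apply geo_mono; auto; lia.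
Qed.

Lemma threshold_range (k m : R) (n i : nat) :
  2 <= k -> 2 <= m -> 0 <= threshold k m n i <= 1.
Proof.
  intros Hk Hm; pose proof (part_size_ge1 m i Hm); pose proof (geo_ratio_range k n i Hk).
  unfold threshold; split; [apply Rle_mult_inv_pos; lra|apply div_le_1; lra].
Qed.

(** All of [P] is freed at the centre: levels lie below 1, so its neighbours keep no colour of
    [P]. *)
Lemma threshold_0 (k m : R) (n : nat) : 2 <= k -> threshold k m n 0 = 1.
Proof.
  intros Hk; pose proof (geo_odd_pos k n Hk).
  unfold threshold, part_size; rewrite Nat.sub_0_r; simpl Nat.even; cbv iota; field; lra.
Qed.

(** Nothing is freed at distance [2 * n + 1], so palettes there lie inside the default and fit the
    outside. *)
Lemma threshold_last (k m : R) (n : nat) : threshold k m n (2 * n + 1) = 0.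
Proof. unfold threshold; rewrite Nat.sub_diag; simpl; unfold Rdiv; ring. Qed.

(** The step is two because parts depend on parity: spheres two apart free colours of the same
    part. *)
Lemma threshold_antitone (k m : R) (n i : nat) :
  2 <= k -> 2 <= m -> threshold k m n (S (S i)) <= threshold k m n i.
Proof.
  intros Hk Hm; pose proof (geo_odd_pos k n Hk); pose proof (part_size_ge1 m i Hm).
  unfold threshold; change (part_size m (S (S i))) with (part_size m i).
  unfold Rdiv; apply Rmult_le_compat_r; [apply Rlt_le, Rinv_0_lt_compat; lra|].
  apply Rmult_le_compat_r; [apply Rlt_le, Rinv_0_lt_compat; lra|].
  apply geo_mono; auto; lia.
Qed.

(** The summands measure the freed colours, the default colours left in the own part, and those left
    in the other part. By the recursion for [geo], [k] times their sum collapses to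
    [k + eps - / geo k (2 * n + 1)], which is at least [k]. *)
Lemma layer_size_ge1 (k eps : R) (n i : nat) :
  2 <= k -> 0 < eps -> 1 <= eps * geo k (2 * n + 1) -> (i < 2 * n + 1)%nat ->
  let m := k + eps in
  let th := threshold k m n in
  1 <= th (S i) * part_size m (S i) +
       (part_size m (S i) - th (S i) * part_size m (S i)) / k +
       (part_size m i - th i * part_size m i) / k.
Proof.
  intros Hk He H1 Hi m th; pose proof (geo_odd_pos k n Hk) as HG.
  assert (Hps : forall i, th i * part_size m i = geo k (2 * n + 1 - i) / geo k (2 * n + 1)).
  { intros j; unfold th, threshold; pose proof (part_size_ge1 m j ltac:(unfold m; lra)).
    field; lra. }
  rewrite !Hps; clear Hps.
  replace (2 * n + 1 - i)%nat with (S (2 * n + 1 - S i)) by lia.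
  change (geo k (S (2 * n + 1 - S i))) with (1 + (k - 1) * geo k (2 * n + 1 - S i)).
  pose proof (part_size_consecutive m i) as Hsum; change m with (k + eps) in Hsum at 3.
  set (G := geo k (2 * n + 1)) in *; set (x := geo k (2 * n + 1 - S i)) in *.
  assert (HGi : / G <= eps).
  { apply (Rmult_le_reg_r G); auto; rewrite Rinv_l; lra. }
  replace (part_size m (S i)) with (k + eps - part_size m i) by lra.
  apply (Rmult_le_reg_r k); [lra|].
  replace ((x / G + (k + eps - part_size m i - x / G) / k +
           (part_size m i - (1 + (k - 1) * x) / G) / k) * k)
    with (k + eps - / G) by (field; lra).
  lra.
Qed.

(** * Palettes around a precoloured vertex *)

Definition part (P : R -> Prop) (i : nat) : R -> Prop :=
  fun x => if Nat.even i then P x else ~ P x.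

Lemma part_succ (P : R -> Prop) (i : nat) (x : R) : part P (S i) x <-> ~ part P i x.
Proof.
  unfold part; rewrite Nat.even_succ, <- Nat.negb_even.
  destruct (Nat.even i); simpl; [tauto|]; split; [auto|apply NNPP].
Qed.

Lemma part_size_spec (m : R) (P : R -> Prop) (i : nat) :
  unit_color_set m P -> 0 <= m ->
  meas (cap (seg m) (part P i)) /\ mu (cap (seg m) (part P i)) = part_size m i.
Proof.
  intros HP Hm.
  assert (Hcap : cap (seg m) P = P).
  { apply set_ext; intros x; unfold cap; split; [tauto|]; intros Hx; split; auto; apply HP; auto. }
  pose proof (mu_split (seg m) P (proj1 (proj2 HP)) (fin_seg m)) as Hs.
  rewrite Hcap, (mu_unit_color_set m P HP), mu_seg in Hs by auto.
  unfold part, part_size; destruct (Nat.even i).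
  - change (fun x => P x) with P; rewrite Hcap; split; [apply HP|].
    apply (mu_unit_color_set m); auto.
  - change (cap (seg m) (fun x => ~ P x)) with (diff (seg m) P).
    split; [apply meas_diff; [apply meas_seg|apply HP]|lra].
Qed.

(* The palette at distance [i] from a precoloured vertex [w] with set [P]. Its own part
   ([P] for even [i], the complement for odd [i]) is freed from the default colouring [F]
   below level [th i]; of the other part only the levels left by distance [i - 1] remain. *)
Definition layer_set (m : R) (lev : R -> R) (th : nat -> R) (P F : R -> Prop) (i : nat)
  : R -> Prop :=
  match i with
  | O => P
  | S j => fun x => seg m x /\
      (part P (S j) x /\ (lev x < th (S j) \/ F x) \/ part P j x /\ ~ lev x < th j /\ F x)
  end.

(** Own parts of consecutive spheres are complementary, so a freed colour can only meet a default
    colour kept in the other part, and the levels separate these. Two default colours are separated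
    by [F] and [F']. *)
Lemma layer_set_disjoint (m : R) (lev : R -> R) (th : nat -> R) (P F F' : R -> Prop) (i : nat) :
  (forall x, seg m x -> lev x < th 0%nat) -> (forall i, th (S (S i)) <= th i) ->
  (forall x, F x -> ~ F' x) ->
  forall x, layer_set m lev th P F i x -> ~ layer_set m lev th P F' (S i) x.
Proof.
  intros H0 Hth HF x; specialize (HF x); destruct i as [|i]; simpl.
  - intros HP [Hx [[H1 _]|[_ [H1 _]]]]; [apply part_succ in H1; auto|auto].
  - intros [Hx [[H1 H2]|[H1 [H2 H3]]]] [_ [[H4 H5]|[H4 [H5 H6]]]].
    + apply part_succ in H4; auto.
    + tauto.
    (* A level below [th (S (S i))] is below [th i], and those levels of this part were dropped by
       sphere [S i]. *)
    + destruct H5 as [H5|H5]; [specialize (Hth i); lra|tauto].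
    + apply part_succ in H4; auto.
Qed.

Lemma saturated_part (ps : list (R -> Prop)) (D P : R -> Prop) (i : nat) :
  In P ps -> saturated ps D (part P i).
Proof.
  intros HP x y _ _ Hxy; specialize (Hxy P HP); unfold part; destruct (Nat.even i); tauto.
Qed.

Lemma saturated_app_l (ps qs : list (R -> Prop)) (D B : R -> Prop) :
  saturated ps D B -> saturated (ps ++ qs) D B.
Proof. intros H x y Hx Hy Hxy; apply H; auto; intros X HX; apply Hxy, in_or_app; auto. Qed.

Lemma saturated_above (ps : list (R -> Prop)) (ths : list R) (lev : R -> R) (th : R)
  (D B : R -> Prop) :
  saturated ps D B -> In th ths ->
  saturated (ps ++ map (fun th x => lev x < th) ths) D (fun x => B x /\ ~ lev x < th).
Proof.
  intros HB Hth x y Hx Hy Hxy [H1 H2]; split.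
  - apply (saturated_app_l ps _ D B HB x y Hx Hy Hxy H1).
  - specialize (Hxy (fun x => lev x < th)); simpl in Hxy.
    rewrite <- Hxy; auto; apply in_or_app; right; apply in_map_iff; eauto.
Qed.

(** The layer set contains three disjoint pieces whose measures come from the uniformity of [lev]
    and [t]; [layer_size_ge1] bounds their sum, and the union is trimmed to measure one. *)
Lemma exists_unit_subset_of_layer_set (ps fs : list (R -> Prop)) (lev t : R -> R)
  (k eps : R) (n j : nat) (P F : R -> Prop) :
  let m := k + eps in
  let th := threshold k m n in
  let ths := map th (seq 0 (2 * n + 2)) in
  2 <= k -> 0 < eps -> 1 <= eps * geo k (2 * n + 1) -> (j < 2 * n + 1)%nat ->
  (forall B th, saturated ps (seg m) B -> In th ths ->
     meas (fun x => cap (seg m) B x /\ lev x < th) /\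
     mu (fun x => cap (seg m) B x /\ lev x < th) = th * mu (cap (seg m) B)) ->
  (forall B F, saturated (ps ++ map (fun th x => lev x < th) ths) (seg m) B -> In F fs ->
     meas (fun x => cap (seg m) B x /\ F (t x)) /\
     mu (fun x => cap (seg m) B x /\ F (t x)) = mu (cap (seg m) B) / k) ->
  In P ps -> unit_color_set m P -> In F fs ->
  exists A, unit_color_set m A /\
    forall x, A x -> layer_set m lev th P (fun x => F (t x)) (S j) x.
Proof.
  intros m th ths Hk He HG Hj Hlev Ht HP HuP HF.
  assert (Hm : 0 <= m) by (unfold m; lra).
  assert (Hin : forall i, (i <= 2 * n + 1)%nat -> In (th i) ths).
  { intros i Hi; apply in_map, in_seq; lia. }
  pose proof (fun i => part_size_spec m P i HuP Hm) as Hpart.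
  pose proof (fun i => saturated_part ps (seg m) P i HP) as Hsat.
  (* Levels from [th i'] upwards take the complementary share of the part, and requiring [F (t x)]
     divides it by [k]. *)
  assert (Habove : forall i i', (i' <= 2 * n + 1)%nat -> part_size m i = part_size m i' ->
    meas (fun x => cap (seg m) (fun x => part P i x /\ ~ lev x < th i') x /\ F (t x)) /\
    mu (fun x => cap (seg m) (fun x => part P i x /\ ~ lev x < th i') x /\ F (t x)) =
      (part_size m i - th i' * part_size m i) / k).
  { intros i i' Hi' Hii'.
    destruct (Ht (fun x => part P i x /\ ~ lev x < th i') F) as [H1 H2]; auto.
    { apply saturated_above; auto. }
    split; auto; rewrite H2; f_equal.
    destruct (Hlev (part P i) (th i')) as [H3 H4]; auto.
    destruct (Hpart i) as [H5 H6].
    rewrite H6 in H4.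
    pose proof (mu_split (cap (seg m) (part P i)) _ H3) as H7.
    rewrite H6 in H7.
    replace (cap (cap (seg m) (part P i)) (fun x => cap (seg m) (part P i) x /\ lev x < th i'))
      with (fun x => cap (seg m) (part P i) x /\ lev x < th i') in H7
      by (apply set_ext; intros x; unfold cap; tauto).
    replace (diff (cap (seg m) (part P i)) (fun x => cap (seg m) (part P i) x /\ lev x < th i'))
      with (cap (seg m) (fun x => part P i x /\ ~ lev x < th i')) in H7
      by (apply set_ext; intros x; unfold cap, diff; tauto).
    rewrite H4 in H7.
    enough (part_size m i = th i' * part_size m i +
      mu (cap (seg m) (fun x => part P i x /\ ~ lev x < th i'))) by lra.
    apply H7, (fin_bounded _ m); intros x [Hx _]; exact Hx. }
  destruct (Hlev (part P (S j)) (th (S j))) as [Hm1 Hv1]; [auto|apply Hin; lia|].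
  destruct (Habove (S j) (S j)) as [Hm2 Hv2]; [lia|auto|].
  destruct (Habove j j) as [Hm3 Hv3]; [lia|auto|].
  destruct (Hpart (S j)) as [_ Hps]; rewrite Hps in Hv1.
  set (A1 := fun x => cap (seg m) (part P (S j)) x /\ lev x < th (S j)) in *.
  set (A2 := fun x => cap (seg m) (fun x => part P (S j) x /\ ~ lev x < th (S j)) x /\ F (t x)) in *.
  set (A3 := fun x => cap (seg m) (fun x => part P j x /\ ~ lev x < th j) x /\ F (t x)) in *.
  assert (H12 : forall x, A1 x -> ~ A2 x).
  { unfold A1, A2, cap; intros x; tauto. }
  assert (H123 : forall x, cup A1 A2 x -> ~ A3 x).
  { unfold cup, A1, A2, A3, cap; intros x; pose proof (part_succ P j x); tauto. }
  assert (Hf : fin A1 /\ fin A2 /\ fin A3).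
  { repeat split; apply (fin_bounded _ m); intros x; unfold A1, A2, A3, cap, seg; tauto. }
  destruct Hf as (Hf1 & Hf2 & Hf3).
  destruct (exists_unit_color_subset m (cup (cup A1 A2) A3)) as (A & HA & HAs).
  - intros x; unfold cup, A1, A2, A3, cap, seg; tauto.
  - apply meas_cup; auto; apply meas_cup; auto.
  - rewrite mu_disjoint_cup, mu_disjoint_cup, Hv1, Hv2, Hv3; auto.
    + apply layer_size_ge1; auto.
    + apply meas_cup; auto.
    + apply (fin_bounded _ m); intros x; unfold cup, A1, A2, cap, seg; tauto.
  - exists A; split; auto; intros x Hx; specialize (HAs x Hx).
    unfold cup, A1, A2, A3, cap in HAs; simpl; tauto.
Qed.

(** * Distance layers around [W] and assembly of the colouring *)

Definition layer (V : Type) (adj : V -> V -> Prop) (W : V -> Prop) (w u : V) (i : nat) : Prop :=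
  W w /\ walk V adj w u i /\ forall j, walk V adj w u j -> (i <= j)%nat.

Lemma exists_layer (V : Type) (adj : V -> V -> Prop) (W : V -> Prop) (w u : V) (i : nat) :
  W w -> walk V adj w u i -> exists j, (j <= i)%nat /\ layer V adj W w u j.
Proof.
  intros Hw; induction i as [i IH] using (well_founded_induction Nat.lt_wf_0); intros Hi.
  destruct (classic (exists j, (j < i)%nat /\ walk V adj w u j)) as [(j & Hj & Hjw)|Hno].
  - destruct (IH j Hj Hjw) as (j' & Hj' & H); exists j'; split; [lia|auto].
  - exists i; split; auto; split; [auto|split; auto].
    intros j Hj; apply Nat.nlt_ge; intros Hlt; apply Hno; eauto.
Qed.

(** Joining the two walks at [u] gives a walk from [w] to [w'] shorter than [d]; this is the
    disjointness of the balls. *)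
Lemma layer_unique (V : Type) (adj : V -> V -> Prop) (W : V -> Prop) (d : nat)
  (w w' u : V) (i i' : nat) :
  (forall u v, adj u v -> adj v u) -> pairwise_far V adj W d -> (i + i' < d)%nat ->
  layer V adj W w u i -> layer V adj W w' u i' -> w = w' /\ i = i'.
Proof.
  intros Hs Hfar Hd (Hw & Hi & Hmin) (Hw' & Hi' & Hmin').
  assert (w = w').
  { apply NNPP; intros Hne.
    pose proof (Hfar w w' Hw Hw' Hne (i + i')%nat
      (walk_app V adj w u w' i i' Hi (walk_sym V adj w' u i' Hs Hi'))); lia. }
  subst w'; split; auto.
  specialize (Hmin _ Hi'); specialize (Hmin' _ Hi); lia.
Qed.

Theorem mainTheorem18 (d : nat) (k eps : R)
  (hd7 : (7 <= d)%nat) (hd3 : Nat.modulo d 4 = 3%nat)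
  (hk : is_rational k) (heps : 0 < eps)
  (hk2 : 2 <= k) (hk2' : k < 2 + 1 / (2 * INR (Nat.div d 4)))
  (hsum : eps + eps * k * sum_f_R0 (fun j => (k - 1) ^ (2 * j + 1)) (Nat.div d 4 - 1) >= 1)
  (V : Type) (adj : V -> V -> Prop) (hG : finite_graph V adj)
  (hcol : fractionally_colorable V adj k)
  (W : V -> Prop) (hW : pairwise_far V adj W d)
  (p : V -> R -> Prop) (hp : fractional_precoloring V W (k + eps) p) :
  precoloring_extends V adj W (k + eps) p.
Proof.
  destruct hG as ((vs & Hvs) & Hsym & Hirr); destruct hcol as [f Hf].
  pose proof (Nat.div_mod_eq d 4) as Hd; rewrite hd3 in Hd.
  set (n := Nat.div d 4) in *; set (m := k + eps) in *.
  assert (Hn : (1 <= n)%nat) by lia.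
  (* The sum in [hsum] runs up to [n - 1], the index at which [geo_odd] yields
     [geo k (2 * n + 1)]. *)
  assert (HG : 1 <= eps * geo k (2 * n + 1)).
  { replace n with (S (n - 1)) by lia; rewrite geo_odd; lra. }
  set (th := threshold k m n); set (ths := map th (seq 0 (2 * n + 2))).
  assert (Hm : 2 <= m) by (unfold m; lra).
  (* Outside [W] nothing is known about [p v]; the conjunct [W v] replaces it by the empty set,
     which is measurable. *)
  set (ps := map (fun v x => W v /\ p v x) vs).
  destruct (exists_level_and_color_maps ps (map f vs) ths m k) as (lev & t & Hlev1 & Hlev & Ht).
  { lra. }
  { apply Forall_forall; intros X HX; apply in_map_iff in HX; destruct HX as (v & <- & _).
    destruct (classic (W v)) as [Hv|Hv]; [|apply meas_empty; tauto].
    replace (fun x => W v /\ p v x) with (p v); [apply (hp v Hv)|].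
    apply set_ext; intros x; tauto. }
  { apply Forall_forall; intros q Hq; apply in_map_iff in Hq; destruct Hq as (i & <- & _).
    apply threshold_range; auto. }
  { apply Forall_forall; intros F HF; apply in_map_iff in HF; destruct HF as (v & <- & _).
    apply Hf. }
  set (lset := fun w u i => layer_set m lev th (p w) (fun x => f u (t x)) i).
  assert (Hpin : forall v, W v -> In (p v) ps).
  { intros v Hv; apply in_map_iff; exists v; split; auto.
    apply set_ext; intros x; tauto. }
  (* The last two clauses overlap at distance exactly [2 * n + 1]: such a vertex must fit its inner
     neighbours through [lset] and the outer ones through the default. *)
  assert (Hchoose : forall u, exists A, unit_color_set m A /\ (W u -> A = p u) /\
    (forall w i, layer V adj W w u i -> (i <= 2 * n + 1)%nat -> forall x, A x -> lset w u i x) /\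
    ((forall w i, layer V adj W w u i -> (2 * n + 1 <= i)%nat) -> forall x, A x -> f u (t x))).
  { intros u; destruct (classic (W u)) as [Hu|Hu].
    - assert (Hlay : layer V adj W u u 0).
      { split; [auto|split; [constructor|intros; lia]]. }
      exists (p u); split; [auto|split; [auto|split]].
      + intros w i Hi Hi' x Hx.
        destruct (layer_unique V adj W d u w u 0 i) as [<- <-]; auto; lia.
      + intros H; specialize (H u 0%nat Hlay); lia.
    - destruct (classic (exists w i, layer V adj W w u i /\ (i <= 2 * n + 1)%nat))
        as [(w & i & Hi & Hi')|Hno].
      + destruct i as [|j].
        { destruct Hi as (Hw & Hwalk & _); exfalso; apply Hu; inversion Hwalk; congruence. }
        destruct (exists_unit_subset_of_layer_set ps (map f vs) lev t k eps n j (p w) (f u))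
          as (A & HA & HAs); auto using in_map; [apply Hpin, Hi|apply hp, Hi|].
        exists A; split; [auto|split; [contradiction|split]].
        * intros w' i' Hl Hle x Hx.
          (* Two radii of at most [2 * n + 1] add up to at most [4 * n + 2 < d]. *)
          destruct (layer_unique V adj W d w w' u (S j) i') as [<- <-]; auto; [lia|].
          apply HAs; auto.
        * intros Hfar x Hx; specialize (Hfar w (S j) Hi).
          assert (S j = 2 * n + 1)%nat as Hj by lia.
          specialize (HAs x Hx); simpl in HAs; rewrite Hj, threshold_last in HAs.
          destruct HAs as [Hs HAs]; specialize (Hlev1 x Hs); unfold seg in Hlev1.
          destruct HAs as [[_ [H|H]]|[_ [_ H]]]; [lra|auto|auto].
      + destruct (Ht (fun _ => True) (f u)) as [Hm1 Hv1]; auto using in_map.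
        { intros x y; auto. }
        replace (cap (seg m) (fun _ => True)) with (seg m) in Hm1, Hv1
          by (apply set_ext; intros x; unfold cap; tauto).
        rewrite mu_seg in Hv1 by lra.
        destruct (exists_unit_color_subset m (fun x => seg m x /\ f u (t x)))
          as (A & HA & HAs); auto.
        { intros x [Hx _]; exact Hx. }
        { rewrite Hv1; apply (Rmult_le_reg_r k); [lra|]; unfold m.
          replace ((k + eps) / k * k) with (k + eps) by (field; lra); lra. }
        exists A; split; [auto|split; [contradiction|split]].
        * intros w i Hl Hle; exfalso; eauto.
        * intros _ x Hx; apply HAs; auto. }
  pose (c := fun u => proj1_sig (constructive_indefinite_description _ (Hchoose u))).
  assert (Hc : forall u, unit_color_set m (c u) /\ (W u -> c u = p u) /\
    (forall w i, layer V adj W w u i -> (i <= 2 * n + 1)%nat -> forall x, c u x -> lset w u i x) /\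
    ((forall w i, layer V adj W w u i -> (2 * n + 1 <= i)%nat) -> forall x, c u x -> f u (t x))).
  { intros u; unfold c; apply proj2_sig. }
  (* One end at distance at most [2 * n] puts the other within [2 * n + 1] of the same [w], so both
     palettes are layer sets, and the distances differ by at most one. *)
  assert (Hdisj : forall u v w i, adj u v -> layer V adj W w u i -> (i <= 2 * n)%nat ->
    forall x, c u x -> ~ c v x).
  { intros u v w i Huv Hi Hin x Hxu Hxv.
    pose proof (walk_app V adj w u v i 1 (proj1 (proj2 Hi)) (walk_edge V adj u v Huv)) as Hwv.
    destruct (exists_layer V adj W w v (i + 1) (proj1 Hi) Hwv) as (j & Hj & Hlj).
    pose proof (walk_app V adj w v u j 1 (proj1 (proj2 Hlj))
                  (walk_edge V adj v u (Hsym u v Huv))) as Hwu.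
    pose proof (proj2 (proj2 Hi) _ Hwu) as Hij.
    pose proof (proj1 (proj2 (proj2 (Hc u))) w i Hi ltac:(lia) x Hxu) as Hsu.
    pose proof (proj1 (proj2 (proj2 (Hc v))) w j Hlj ltac:(lia) x Hxv) as Hsv.
    assert (H0 : forall x, seg m x -> lev x < th 0%nat).
    { intros y Hy; unfold th; rewrite threshold_0 by auto; apply Hlev1; auto. }
    assert (Hanti : forall i, th (S (S i)) <= th i) by (intros; apply threshold_antitone; auto).
    assert (Hfuv : forall x, f u (t x) -> ~ f v (t x)).
    { intros y Hy1 Hy2; apply (proj2 Hf u v Huv (t y)); auto. }
    destruct (Nat.lt_trichotomy i j) as [Hlt|[Heq|Hlt]].
    - replace j with (S i) in Hsv by lia.
      apply (layer_set_disjoint m lev th (p w) _ _ i H0 Hanti Hfuv x Hsu Hsv).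
    (* Equal distances close a walk of odd length [2 * i + 1] with [i <= 2 * n], against
       [2 * n * (k - 2) < 1]. *)
    - subst j.
      assert (Hcl : walk V adj u v (2 * i)).
      { replace (2 * i)%nat with (i + i)%nat by lia.
        apply (walk_app V adj u w v); [apply walk_sym; auto; apply Hi|apply Hlj]. }
      pose proof (odd_closed_walk_bound V adj k f i u v Hf ltac:(lra) Hcl Huv) as Hodd.
      assert (Hn0 : 1 <= INR n) by (apply (le_INR 1); lia).
      assert (HiR : INR i <= 2 * INR n).
      { replace (2 * INR n) with (INR (2 * n)) by (rewrite mult_INR; simpl; ring).
        apply le_INR; lia. }
      assert (Hlt : 2 * INR n * (k - 2) < 1).
      { apply (Rmult_lt_reg_r (/ (2 * INR n))); [apply Rinv_0_lt_compat; lra|].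
        replace (2 * INR n * (k - 2) * / (2 * INR n)) with (k - 2) by (field; lra).
        unfold Rdiv in hk2'; lra. }
      nra.
    - replace i with (S j) in Hsu by lia.
      apply (layer_set_disjoint m lev th (p w) (fun x => f v (t x)) (fun x => f u (t x))
               j H0 Hanti) with (x := x); auto.
      intros y Hy1 Hy2; apply (Hfuv y); auto. }
  exists c; split; [split|].
  - intros u; apply Hc.
  - intros u v Huv x [Hxu Hxv].
    (* If neither end is within [2 * n] of [W], both ends use default colours, which [f] keeps
       apart. *)
    destruct (classic (exists w i, layer V adj W w u i /\ (i <= 2 * n)%nat))
      as [(w & i & Hi & Hin)|Hnu]; [apply (Hdisj u v w i Huv Hi Hin x Hxu Hxv)|].
    destruct (classic (exists w i, layer V adj W w v i /\ (i <= 2 * n)%nat))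
      as [(w & i & Hi & Hin)|Hnv]; [apply (Hdisj v u w i (Hsym u v Huv) Hi Hin x Hxv Hxu)|].
    apply (proj2 Hf u v Huv (t x)); split.
    + apply (proj2 (proj2 (proj2 (Hc u)))); auto.
      intros w i Hi; apply Nat.nlt_ge; intros Hlt; apply Hnu; exists w, i; split; [auto|lia].
    + apply (proj2 (proj2 (proj2 (Hc v)))); auto.
      intros w i Hi; apply Nat.nlt_ge; intros Hlt; apply Hnv; exists w, i; split; [auto|lia].
  - intros v Hv x; rewrite (proj1 (proj2 (Hc v)) Hv); tauto.
Qed.
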